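(* Let $\gamma>0$ be a left-c.e. real. Within the class of left-c.e. metric spaces of diameter at most $\gamma$, there is a left-c.e. metric space $\mathcal{U}$ which is universal with respect to computable isometric embeddings: every left-c.e. metric space of diameter at most $\gamma$ admits a computable isometric embedding into $\mathcal{U}$.
   Context: A Polish metric space with a designated dense sequence $\mathcal{M}=(M,d,(p_k)_{k\in\mathbb{N}})$ (the $p_k$ are the special points) is a left-c.e. metric space if $d(p_i,p_k)$ is a left-c.e. real (limit of a computable increasing sequence of rationals) uniformly in $i,k$. A Cauchy name in $\mathcal{M}$ is a function $g:\mathbb{N}\to\mathbb{N}$ with $d(p_{g(i)},p_{g(k)})\le 2^{-i}$ for all $i\le k$. An isometric embedding $f$ from $\mathcal{M}=(M,d,(p_k))$ into $\mathcal{N}=(N,d',(q_k))$ is computable if, uniformly in $k$, one can compute a Cauchy name (in $\mathcal{N}$) for $f(p_k)$. *)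

(* Defs.v *)
From Stdlib Require Import Reals Lra List.
Import ListNotations.
Open Scope R_scope.

Inductive recf : Type :=
| RZero : recf
| RSucc : recf
| RProj : nat -> recf
| RComp : recf -> list recf -> recf
| RPrec : recf -> recf -> recf
| RMin  : recf -> recf.

Inductive eval : recf -> list nat -> nat -> Prop :=
| eZero v : eval RZero v 0
| eSucc x v : eval RSucc (x :: v) (S x)
| eProj i v : (i < length v)%nat -> eval (RProj i) v (nth i v 0%nat)
| eComp f gs v ws y : evals gs v ws -> eval f ws y -> eval (RComp f gs) v y
| ePrec0 f g v y : eval f v y -> eval (RPrec f g) (0%nat :: v) y
| ePrecS f g n v z y :
    eval (RPrec f g) (n :: v) z -> eval g (n :: z :: v) y ->
    eval (RPrec f g) (S n :: v) y
| eMin f v n :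
    eval f (n :: v) 0%nat ->
    (forall m, (m < n)%nat -> exists k, eval f (m :: v) (S k)) ->
    eval (RMin f) v n
with evals : list recf -> list nat -> list nat -> Prop :=
| esNil v : evals nil v nil
| esCons g gs v y ys : eval g v y -> evals gs v ys -> evals (g :: gs) v (y :: ys).

Definition computable2 (f : nat -> nat -> nat) : Prop :=
  exists e, forall a b, eval e [a; b] (f a b).

Definition computable3 (f : nat -> nat -> nat -> nat) : Prop :=
  exists e, forall a b c, eval e [a; b; c] (f a b c).

Definition ratcode (a b c : nat) : R := (INR a - INR b) / (INR c + 1).

Definition left_ce (x : R) : Prop :=
  exists a b c : nat -> nat -> nat,
    (* computable sequences (the dummy first argument is ignored) *)
    computable2 a /\ computable2 b /\ computable2 c /\
    let q s := ratcode (a 0%nat s) (b 0%nat s) (c 0%nat s) in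
    (forall s, q s <= q (S s)) /\ Un_cv q x.

Record PolishSpace : Type := {
  carrier : Type;
  dist : carrier -> carrier -> R;
  pts : nat -> carrier;
  dist_eq0 : forall x y, dist x y = 0 <-> x = y;
  dist_sym : forall x y, dist x y = dist y x;
  dist_tri : forall x y z, dist x z <= dist x y + dist y z;
  complete : forall u : nat -> carrier,
      (forall eps, eps > 0 -> exists N, forall n m, (n >= N)%nat -> (m >= N)%nat ->
          dist (u n) (u m) < eps) ->
      exists l, Un_cv (fun n => dist (u n) l) 0;
  dense : forall x eps, eps > 0 -> exists k, dist x (pts k) < eps
}.

Definition left_ce_space (M : PolishSpace) : Prop :=
  exists a b c : nat -> nat -> nat -> nat,
    computable3 a /\ computable3 b /\ computable3 c /\
    let q i k s := ratcode (a i k s) (b i k s) (c i k s) in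
    forall i k,
      (forall s, q i k s <= q i k (S s)) /\
      Un_cv (q i k) (dist M (pts M i) (pts M k)).

Definition diam_le (M : PolishSpace) (g : R) : Prop :=
  forall x y : carrier M, dist M x y <= g.

Definition cauchy_name (N : PolishSpace) (g : nat -> nat) : Prop :=
  forall i k, (i <= k)%nat -> dist N (pts N (g i)) (pts N (g k)) <= (/2) ^ i.

Definition names (N : PolishSpace) (g : nat -> nat) (x : carrier N) : Prop :=
  cauchy_name N g /\ Un_cv (fun i => dist N (pts N (g i)) x) 0.

Definition isometric_embedding (M N : PolishSpace) (f : carrier M -> carrier N) : Prop :=
  forall x y, dist N (f x) (f y) = dist M x y.

Definition computable_embedding (M N : PolishSpace) (f : carrier M -> carrier N) : Prop :=
  isometric_embedding M N f /\
  exists G : nat -> nat -> nat, computable2 G /\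
    forall k, names N (G k) (f (pts M k)).

(* Main.v *)
(* The universal space is the completion of a disjoint union of components, one for each number [e]
   of a partial recursive function, with mutual distance [gamma]. The function number [e] is read as
   a double sequence of rational lower bounds for a metric on nat. Its component accepts the points
   one after the other: a rational metric on [0 .. n] is adopted only after it has been checked to
   satisfy the triangle inequality, to be bounded by [gamma], to dominate the metric adopted before,
   and to stay below the current lower bounds. So the adopted metrics increase to a left-c.e.
   pseudometric, even if the search gets stuck. If the lower bounds converge to a metric [d] of
   diameter at most [gamma], the search never gets stuck: the metric [d], shrunk by a factor
   [n / (n + 1)] and rounded up to a fine grid, passes the test, because rounding up is monotone,
   subadditive and left-continuous. A special point of the given space is then sent to the point of
   the same number in its component, named together with a stage at which it has been accepted. *)

From Stdlib Require Import Reals Lra Lia List Arith Cantor.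
From Stdlib Require Import ProofIrrelevance FunctionalExtensionality ClassicalEpsilon.
Require Import Defs.
Import ListNotations.

(** * Completion of a countable pseudometric space *)

Local Open Scope R_scope.

Section Completion.
Context (d : nat -> nat -> R) (g : R)
  (d0 : forall i, d i i = 0) (dsym : forall i k, d i k = d k i)
  (dtri : forall i j k, d i k <= d i j + d j k) (dle : forall i k, d i k <= g).

(* Kuratowski: a point is represented by its distance function, and the completion is the
   closure of these functions for the supremum distance. *)
Definition cpred (f : nat -> R) : Prop :=
  forall eps, eps > 0 -> exists i, forall k, Rabs (f k - d i k) <= eps.

Definition ccar : Type := {f : nat -> R | cpred f}.

Lemma pseudo_nonneg i k : 0 <= d i k.
Proof. generalize (dtri i k i); rewrite d0, (dsym k i); lra. Qed.

Lemma ccar_bounded (x : ccar) k : Rabs (proj1_sig x k) <= 1 + g.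
Proof.
  destruct x as [f Hf]; simpl; destruct (Hf 1 ltac:(lra)) as [i Hi].
  specialize (Hi k); generalize (pseudo_nonneg i k) (dle i k); revert Hi.
  unfold Rabs; repeat destruct Rcase_abs; lra.
Qed.

Definition gaps (x y : ccar) (r : R) : Prop :=
  exists k, r = Rabs (proj1_sig x k - proj1_sig y k).

Lemma gaps_bound x y : bound (gaps x y).
Proof.
  exists (2 * (1 + g)); intros r [k ->].
  generalize (ccar_bounded x k) (ccar_bounded y k).
  unfold Rabs; repeat destruct Rcase_abs; lra.
Qed.

Lemma gaps_inhabited x y : exists r, gaps x y r.
Proof. now exists (Rabs (proj1_sig x 0%nat - proj1_sig y 0%nat)), 0%nat. Qed.

Definition supdist (x y : ccar) : R :=
  proj1_sig (completeness (gaps x y) (gaps_bound x y) (gaps_inhabited x y)).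

Lemma supdist_ub x y k : Rabs (proj1_sig x k - proj1_sig y k) <= supdist x y.
Proof. unfold supdist; destruct completeness as [m Hm]; simpl; apply (proj1 Hm); now exists k. Qed.

Lemma supdist_le x y r :
  (forall k, Rabs (proj1_sig x k - proj1_sig y k) <= r) -> supdist x y <= r.
Proof.
  intros H; unfold supdist; destruct completeness as [m Hm]; simpl.
  apply (proj2 Hm); intros s [k ->]; apply H.
Qed.

Lemma supdist_nonneg x y : 0 <= supdist x y.
Proof. eapply Rle_trans; [apply Rabs_pos|apply (supdist_ub x y 0)]. Qed.

Lemma supdist_eq0 x y : supdist x y = 0 <-> x = y.
Proof.
  split.
  - intros H; assert (E : proj1_sig x = proj1_sig y).
    { apply functional_extensionality; intros k; generalize (supdist_ub x y k); rewrite H.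
      unfold Rabs; destruct Rcase_abs; lra. }
    destruct x as [f Hf], y as [h Hh]; simpl in E; subst h; f_equal; apply proof_irrelevance.
  - intros ->; apply Rle_antisym; [|apply supdist_nonneg].
    apply supdist_le; intros k; rewrite Rminus_diag, Rabs_R0; lra.
Qed.

Lemma supdist_sym x y : supdist x y = supdist y x.
Proof.
  apply Rle_antisym; apply supdist_le; intros k; rewrite Rabs_minus_sym; apply supdist_ub.
Qed.

Lemma supdist_tri x y z : supdist x z <= supdist x y + supdist y z.
Proof.
  apply supdist_le; intros k; generalize (supdist_ub x y k) (supdist_ub y z k).
  unfold Rabs; repeat destruct Rcase_abs; lra.
Qed.

Definition cpt (i : nat) : ccar.
Proof.
  exists (d i); intros eps He; exists i; intros k; rewrite Rminus_diag, Rabs_R0; lra.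
Defined.

(** The triangle inequality bounds every gap [d i j - d k j] by [d i k], and the gap at [j = k]
    attains it. *)
Lemma supdist_cpt i k : supdist (cpt i) (cpt k) = d i k.
Proof.
  apply Rle_antisym.
  - apply supdist_le; intros j; simpl; generalize (dtri i k j) (dtri k i j); rewrite (dsym k i).
    unfold Rabs; destruct Rcase_abs; lra.
  - generalize (supdist_ub (cpt i) (cpt k) k); simpl; rewrite d0, Rminus_0_r.
    intros H; eapply Rle_trans; [apply Rle_abs|exact H].
Qed.

Lemma supdist_dense x eps : eps > 0 -> exists k, supdist x (cpt k) < eps.
Proof.
  intros He; destruct (proj2_sig x (eps / 2) ltac:(lra)) as [i Hi]; exists i.
  apply Rle_lt_trans with (eps / 2); [now apply supdist_le|lra].
Qed.

Lemma supdist_complete (u : nat -> ccar) :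
  (forall eps, eps > 0 -> exists N, forall n m, (n >= N)%nat -> (m >= N)%nat ->
     supdist (u n) (u m) < eps) ->
  exists l, Un_cv (fun n => supdist (u n) l) 0.
Proof.
  intros Hu.
  assert (HC : forall k, {l | Un_cv (fun n => proj1_sig (u n) k) l}).
  { intros k; apply R_complete; intros eps He; destruct (Hu eps He) as [N HN]; exists N.
    intros n m Hn Hm; eapply Rle_lt_trans; [apply supdist_ub|now apply HN]. }
  set (f k := proj1_sig (HC k)).
  (* The Cauchy condition is uniform in [k], so the pointwise limit is a uniform one and inherits
     [cpred]. *)
  assert (Hf : forall eps, eps > 0 -> exists N, forall n, (n >= N)%nat ->
                 forall k, Rabs (proj1_sig (u n) k - f k) <= eps).
  { intros eps He; destruct (Hu (eps / 2) ltac:(lra)) as [N HN]; exists N; intros n Hn k.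
    unfold f; destruct (HC k) as [l Hl]; simpl.
    destruct (Hl (eps / 2) ltac:(lra)) as [N' HN'].
    specialize (HN' (max N N') ltac:(lia)).
    generalize (supdist_ub (u n) (u (max N N')) k) (HN n (max N N') Hn ltac:(lia)).
    revert HN'; unfold Rdist, Rabs; repeat destruct Rcase_abs; lra. }
  assert (Pf : cpred f).
  { intros eps He; destruct (Hf (eps / 2) ltac:(lra)) as [N HN].
    destruct (proj2_sig (u N) (eps / 2) ltac:(lra)) as [i Hi]; exists i; intros k.
    generalize (HN N (le_n _) k) (Hi k); unfold Rabs; repeat destruct Rcase_abs; lra. }
  exists (exist _ f Pf); intros eps He; destruct (Hf (eps / 2) ltac:(lra)) as [N HN].
  exists N; intros n Hn; unfold Rdist; rewrite Rminus_0_r, Rabs_pos_eq; [|apply supdist_nonneg].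
  apply Rle_lt_trans with (eps / 2); [apply supdist_le; exact (HN n Hn)|lra].
Qed.

Definition completion : PolishSpace :=
  Build_PolishSpace ccar supdist cpt supdist_eq0 supdist_sym supdist_tri
    supdist_complete supdist_dense.

End Completion.

(** * Polish spaces: diameter and isometries determined on the special points *)

Lemma dist_refl (M : PolishSpace) x : dist M x x = 0.
Proof. now apply dist_eq0. Qed.

Lemma dist_nonneg (M : PolishSpace) x y : 0 <= dist M x y.
Proof.
  generalize (dist_tri M x y x); rewrite dist_refl, (dist_sym M y x); lra.
Qed.

Lemma Un_cv_const c : Un_cv (fun _ => c) c.
Proof. intros eps He; exists 0%nat; intros; rewrite Rdist_eq; exact He. Qed.

Lemma Rle_eps a b : (forall eps, eps > 0 -> a <= b + eps) -> a <= b.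
Proof.
  intros H; destruct (Rle_lt_dec a b) as [|Hlt]; [assumption|].
  specialize (H ((a - b) / 2) ltac:(lra)); lra.
Qed.

Lemma diam_le_pts (M : PolishSpace) g :
  (forall i k, dist M (pts M i) (pts M k) <= g) -> diam_le M g.
Proof.
  intros H x y; apply Rle_eps; intros eps He.
  destruct (dense M x (eps / 2) ltac:(lra)) as [i Hi].
  destruct (dense M y (eps / 2) ltac:(lra)) as [k Hk].
  generalize (dist_tri M x (pts M i) y) (dist_tri M (pts M i) (pts M k) y) (H i k).
  rewrite (dist_sym M (pts M k) y); lra.
Qed.

Lemma half_pow_small eps : eps > 0 -> exists N, forall n, (n >= N)%nat -> (/ 2) ^ n < eps.
Proof.
  intros He; destruct (pow_lt_1_zero (/ 2)) with (y := eps) as [N HN]; auto.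
  - rewrite Rabs_pos_eq; lra.
  - exists N; intros n Hn; eapply Rle_lt_trans; [apply Rle_abs|now apply HN].
Qed.

Lemma isometric_extension (M N : PolishSpace) (h : nat -> carrier N) :
  (forall i k, dist N (h i) (h k) = dist M (pts M i) (pts M k)) ->
  exists f, isometric_embedding M N f /\ forall i, f (pts M i) = h i.
Proof.
  intros Hh.
  (* The image of [x] is described by its distances to all [h i], independently of the approximating
     sequence that produces it; this description alone yields the isometry. *)
  assert (HX : forall x, {y | forall i, dist N y (h i) = dist M x (pts M i)}).
  { intros x; apply constructive_indefinite_description.
    assert (Hs : forall n, {i | dist M x (pts M i) < (/ 2) ^ n}).
    { intros n; apply constructive_indefinite_description, dense, pow_lt; lra. }
    set (a n := proj1_sig (Hs n)).
    assert (Ha : forall n, dist M x (pts M (a n)) < (/ 2) ^ n)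
      by (intros n; unfold a; now destruct (Hs n)).
    destruct (complete N (fun n => h (a n))) as [y Hy].
    - intros eps He; destruct (half_pow_small (eps / 2) ltac:(lra)) as [K HK].
      exists K; intros n m Hn Hm; rewrite Hh.
      generalize (dist_tri M (pts M (a n)) x (pts M (a m))) (Ha n) (Ha m) (HK n Hn) (HK m Hm).
      rewrite (dist_sym M (pts M (a n)) x); lra.
    - exists y; intros i.
      assert (HE : forall eps, eps > 0 -> exists n,
                dist N (h (a n)) y < eps /\ dist M x (pts M (a n)) < eps).
      { intros eps He; destruct (Hy eps He) as [K1 HK1], (half_pow_small eps He) as [K2 HK2].
        exists (max K1 K2); split.
        - specialize (HK1 (max K1 K2) ltac:(lia)); unfold Rdist in HK1.
          rewrite Rminus_0_r, Rabs_pos_eq in HK1; [exact HK1|apply dist_nonneg].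
        - eapply Rlt_trans; [apply Ha|apply HK2; lia]. }
      apply Rle_antisym; apply Rle_eps; intros eps He;
        destruct (HE (eps / 2) ltac:(lra)) as [n [H1 H2]].
      + generalize (dist_tri N y (h (a n)) (h i)) (dist_tri M (pts M (a n)) x (pts M i)).
        rewrite Hh, (dist_sym N y (h (a n))), (dist_sym M (pts M (a n)) x); lra.
      + generalize (dist_tri N (h (a n)) y (h i)) (dist_tri M x (pts M (a n)) (pts M i)).
        rewrite Hh; lra. }
  exists (fun x => proj1_sig (HX x)); split.
  - intros x y; destruct (HX x) as [x' Hx], (HX y) as [y' Hy]; simpl.
    apply Rle_antisym; apply Rle_eps; intros eps He;
      destruct (dense M x (eps / 2) ltac:(lra)) as [i Hi].
    + generalize (dist_tri N x' (h i) y') (dist_tri M (pts M i) x y).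
      rewrite (dist_sym N (h i) y'), Hx, Hy, (dist_sym M y), (dist_sym M (pts M i) x); lra.
    + generalize (dist_tri M x (pts M i) y) (dist_tri N (h i) x' y').
      rewrite (dist_sym N (h i) x'), (dist_sym M (pts M i) y), Hx, <- Hy, (dist_sym N y'); lra.
  - intros i; destruct (HX (pts M i)) as [y Hy]; simpl.
    apply (dist_eq0 N); rewrite Hy; apply dist_refl.
Qed.

(** * Computable functions *)

Local Open Scope nat_scope.


(** Only lists of length [n] matter. With arguments kept in a list, projections are [nth] and
    minimization prepends the candidate. *)
Definition cmp (n : nat) (F : list nat -> nat) : Prop :=
  exists e, forall v, length v = n -> eval e v (F v).

Lemma cmp_proj n i : i < n -> cmp n (fun v => nth i v 0).
Proof. intros Hi; exists (RProj i); intros v Hv; constructor; lia. Qed.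

Lemma cmp_op1 n op F : cmp 1 (fun v => op (nth 0 v 0)) -> cmp n F ->
  cmp n (fun v => op (F v)).
Proof.
  intros [e He] [f Hf]; exists (RComp e [f]); intros v Hv.
  apply eComp with [F v]; [repeat constructor; auto|].
  apply (He [F v]); reflexivity.
Qed.

Lemma cmp_op2 n op F G : computable2 op -> cmp n F -> cmp n G ->
  cmp n (fun v => op (F v) (G v)).
Proof.
  intros [e He] [f Hf] [g Hg]; exists (RComp e [f; g]); intros v Hv.
  apply eComp with [F v; G v]; [repeat constructor; auto|apply He].
Qed.

Lemma cmp_const n c : cmp n (fun _ => c).
Proof.
  induction c as [|c [e He]].
  - exists RZero; intros; constructor.
  - exists (RComp RSucc [e]); intros v Hv; apply eComp with [c].
    + repeat constructor; auto.
    + constructor.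
Qed.

Lemma cmp_S n F : cmp n F -> cmp n (fun v => S (F v)).
Proof.
  apply cmp_op1; exists RSucc; intros [|a [|]]; try discriminate; constructor.
Qed.

Lemma cmp_min n F G : cmp (S n) G ->
  (forall v, length v = n ->
     G (F v :: v) = 0 /\ forall m, m < F v -> G (m :: v) <> 0) ->
  cmp n F.
Proof.
  intros [g Hg] H; exists (RMin g); intros v Hv.
  destruct (H v Hv) as [H0 Hm]; constructor.
  - rewrite <- H0; apply Hg; simpl; lia.
  - intros m Hlt; exists (pred (G (m :: v))).
    specialize (Hm m Hlt); specialize (Hg (m :: v)).
    destruct (G (m :: v)); [easy|apply Hg; simpl; lia].
Qed.

Lemma computable2_cmp op : cmp 2 (fun v => op (nth 0 v 0) (nth 1 v 0)) <-> computable2 op.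
Proof.
  split; intros [e He]; exists e.
  - intros a b; apply (He [a; b]); reflexivity.
  - intros [|a [|b [|]]]; try discriminate; intros _; apply He.
Qed.

Lemma computable2_rec A H op : cmp 1 A -> cmp 3 H ->
  (forall x, op 0 x = A [x]) -> (forall n x, op (S n) x = H [n; op n x; x]) ->
  computable2 op.
Proof.
  intros [a Ha] [h Hh] H0 HS; exists (RPrec a h); intros n x.
  induction n as [|n IH].
  - rewrite H0; constructor; now apply Ha.
  - rewrite HS; apply ePrecS with (op n x); [exact IH|now apply Hh].
Qed.

Lemma computable2_add : computable2 Nat.add.
Proof.
  apply computable2_rec with (fun v => nth 0 v 0) (fun v => S (nth 1 v 0)); auto.
  - apply cmp_proj; lia.
  - apply cmp_S, cmp_proj; lia.
Qed.

Lemma computable2_mul : computable2 Nat.mul.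
Proof.
  apply computable2_rec with (fun v => 0) (fun v => nth 2 v 0 + nth 1 v 0); auto.
  - apply cmp_const.
  - apply cmp_op2; [apply computable2_add| |]; apply cmp_proj; lia.
Qed.

Lemma cmp_pred n F : cmp n F -> cmp n (fun v => pred (F v)).
Proof.
  apply cmp_op1; exists (RPrec RZero (RProj 0)).
  intros [|a [|]]; try discriminate; intros _; simpl.
  assert (H : forall k v, eval (RPrec RZero (RProj 0)) (k :: v) (pred k)).
  { induction k; intros v; [repeat constructor|].
    apply ePrecS with (pred k); [apply IHk|].
    change (pred (S k)) with (nth 0 (k :: pred k :: v) 0); constructor; simpl; lia. }
  apply H.
Qed.

Lemma computable2_flip op : computable2 op -> computable2 (fun a b => op b a).
Proof.
  intros H; apply computable2_cmp, (cmp_op2 2 op); auto; apply cmp_proj; lia.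
Qed.

Lemma computable2_sub : computable2 Nat.sub.
Proof.
  apply (computable2_flip (fun n x => x - n)).
  apply computable2_rec with (fun v => nth 0 v 0) (fun v => pred (nth 1 v 0)).
  - apply cmp_proj; lia.
  - apply cmp_pred, cmp_proj; lia.
  - intros; simpl; lia.
  - intros; simpl; lia.
Qed.

Ltac cmp := repeat first
  [ assumption
  | apply cmp_const
  | apply cmp_proj; lia
  | apply cmp_S
  | apply cmp_pred
  | apply (cmp_op2 _ Nat.add); [exact computable2_add| |]
  | apply (cmp_op2 _ Nat.mul); [exact computable2_mul| |]
  | apply (cmp_op2 _ Nat.sub); [exact computable2_sub| |] ].

(** * Cantor pairing *)

Definition pr (x y : nat) : nat := to_nat (x, y).
Definition p1 (z : nat) : nat := fst (of_nat z).
Definition p2 (z : nat) : nat := snd (of_nat z).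

Lemma p1_pr x y : p1 (pr x y) = x.
Proof. unfold p1, pr; now rewrite cancel_of_to. Qed.

Lemma p2_pr x y : p2 (pr x y) = y.
Proof. unfold p2, pr; now rewrite cancel_of_to. Qed.

Lemma pr_p z : pr (p1 z) (p2 z) = z.
Proof. unfold pr, p1, p2; rewrite <- surjective_pairing; apply cancel_to_of. Qed.

Lemma pr_spec x y : 2 * pr x y = 2 * y + (y + x) * S (y + x).
Proof. unfold pr; generalize (to_nat_spec x y); lia. Qed.

Lemma pr_ge2 x y : y <= pr x y.
Proof. generalize (pr_spec x y); lia. Qed.

Opaque pr p1 p2.

(** By [pr_spec], [2 * pr x y] is a polynomial in [x] and [y], so the pair is the least number whose
    double reaches that polynomial. *)
Lemma computable2_pr : computable2 pr.
Proof.
  apply computable2_cmp.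
  apply cmp_min with (fun w =>
    (2 * nth 2 w 0 + (nth 2 w 0 + nth 1 w 0) * S (nth 2 w 0 + nth 1 w 0)) - 2 * nth 0 w 0).
  - cmp.
  - intros [|a [|b [|]]]; try discriminate; intros _; simpl nth.
    generalize (pr_spec a b); intros H; split; intros; lia.
Qed.

(** The sum of the coordinates is the number of the diagonal: the least [m] such that the triangular
    number of [m + 1] exceeds the code. The second coordinate is the offset on that diagonal. *)
Lemma cmp_p2_p1 :
  cmp 1 (fun v => p2 (nth 0 v 0) + p1 (nth 0 v 0)) /\ cmp 1 (fun v => p2 (nth 0 v 0)).
Proof.
  assert (HD : cmp 1 (fun v => p2 (nth 0 v 0) + p1 (nth 0 v 0))).
  { apply cmp_min with (fun w =>
      2 * S (nth 1 w 0) - S (nth 0 w 0) * S (S (nth 0 w 0))).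
    - cmp.
    - intros [|a [|]]; try discriminate; intros _; simpl nth.
      generalize (pr_spec (p1 a) (p2 a)); rewrite pr_p; intros H; split; intros; nia. }
  split; [exact HD|].
  apply cmp_min with (fun w =>
    (2 * nth 1 w 0 - (p2 (nth 1 w 0) + p1 (nth 1 w 0)) * S (p2 (nth 1 w 0) + p1 (nth 1 w 0)))
    - 2 * nth 0 w 0).
  - assert (HD2 : cmp 2 (fun v => p2 (nth 1 v 0) + p1 (nth 1 v 0))).
    { apply (cmp_op1 2 (fun a => p2 a + p1 a) (fun v => nth 1 v 0)); cmp. }
    cmp.
  - intros [|a [|]]; try discriminate; intros _; simpl nth.
    generalize (pr_spec (p1 a) (p2 a)); rewrite pr_p; intros H; split; intros; lia.
Qed.

(** * Unary computable functions, with several arguments packed by pairing *)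

Definition comp (f : nat -> nat) : Prop := exists e, forall x, eval e [x] (f x).

Lemma comp_cmp f : comp f <-> cmp 1 (fun v => f (nth 0 v 0)).
Proof.
  split; intros [e He]; exists e.
  - intros [|a [|]]; try discriminate; intros _; apply He.
  - intros a; apply (He [a]); reflexivity.
Qed.

Lemma comp_comp g f : comp g -> comp f -> comp (fun x => g (f x)).
Proof. rewrite !comp_cmp; intros Hg Hf; now apply (cmp_op1 1 g). Qed.

Lemma comp_op2 op f g : computable2 op -> comp f -> comp g -> comp (fun x => op (f x) (g x)).
Proof.
  rewrite !comp_cmp; intros H Hf Hg.
  apply (cmp_op2 1 op (fun v => f (nth 0 v 0)) (fun v => g (nth 0 v 0))); auto.
Qed.

Lemma comp_op3 op f g h : computable3 op -> comp f -> comp g -> comp h ->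
  comp (fun x => op (f x) (g x) (h x)).
Proof.
  intros [e He] [ef Hf] [eg Hg] [eh Hh]; exists (RComp e [ef; eg; eh]); intros x.
  apply eComp with [f x; g x; h x]; [repeat constructor; auto|apply He].
Qed.

Lemma comp_const c : comp (fun _ => c).
Proof. apply comp_cmp, cmp_const. Qed.

Lemma comp_id : comp (fun x => x).
Proof. apply comp_cmp, cmp_proj; lia. Qed.

Lemma comp_S f : comp f -> comp (fun x => S (f x)).
Proof. intros H; apply (comp_comp S f); auto; apply comp_cmp; cmp. Qed.

Lemma comp_pred f : comp f -> comp (fun x => pred (f x)).
Proof. intros H; apply (comp_comp pred f); auto; apply comp_cmp; cmp. Qed.

Lemma comp_add f g : comp f -> comp g -> comp (fun x => f x + g x).
Proof. apply comp_op2, computable2_add. Qed.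

Lemma comp_mul f g : comp f -> comp g -> comp (fun x => f x * g x).
Proof. apply comp_op2, computable2_mul. Qed.

Lemma comp_sub f g : comp f -> comp g -> comp (fun x => f x - g x).
Proof. apply comp_op2, computable2_sub. Qed.

Lemma comp_pr f g : comp f -> comp g -> comp (fun x => pr (f x) (g x)).
Proof. apply comp_op2, computable2_pr. Qed.

Lemma comp_p2 f : comp f -> comp (fun x => p2 (f x)).
Proof. intros H; apply (comp_comp p2 f); auto; apply comp_cmp, cmp_p2_p1. Qed.

Lemma comp_ext f g : (forall x, f x = g x) -> comp f -> comp g.
Proof. intros H [e He]; exists e; intros x; rewrite <- H; apply He. Qed.

Lemma comp_p1 f : comp f -> comp (fun x => p1 (f x)).
Proof.
  intros H; apply (comp_comp p1 f); auto.
  apply comp_ext with (fun x => (p2 x + p1 x) - p2 x); [intros; lia|].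
  apply comp_cmp, (cmp_op2 1 Nat.sub); [exact computable2_sub| |]; apply cmp_p2_p1.
Qed.

Lemma comp_min f g : comp (fun w => g (p1 w) (p2 w)) ->
  (forall x, g (f x) x = 0 /\ forall m, m < f x -> g m x <> 0) -> comp f.
Proof.
  intros Hg H; apply comp_cmp.
  apply cmp_min with (fun w => g (nth 0 w 0) (nth 1 w 0)).
  - apply comp_cmp in Hg.
    assert (H2 : cmp 2 (fun v => pr (nth 0 v 0) (nth 1 v 0))).
    { apply computable2_cmp, computable2_pr. }
    destruct (cmp_op1 2 (fun w => g (p1 w) (p2 w)) _ Hg H2) as [e He].
    exists e; intros v Hv; specialize (He v Hv); cbv beta in He.
    now rewrite p1_pr, p2_pr in He.
  - intros [|a [|]]; try discriminate; intros _; apply H.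
Qed.

Definition nrec (n a : nat) (h : nat -> nat -> nat) : nat :=
  nat_rect (fun _ => nat) a h n.

Lemma comp_nrec n a h : comp n -> comp a ->
  comp (fun w => h (p1 w) (p1 (p2 w)) (p2 (p2 w))) ->
  comp (fun x => nrec (n x) (a x) (h x)).
Proof.
  intros [en Hn] [ea Ha] [eh Hh]; destruct computable2_pr as [ep Hp].
  (* Repacks the recursion vector [[m; z; x]] as the triple [pr x (pr m z)] that [h] expects. *)
  set (G := RComp eh [RComp ep [RProj 2; RComp ep [RProj 0; RProj 1]]]).
  exists (RComp (RPrec ea G) [en; RProj 0]); intros x.
  apply eComp with [n x; x].
  - constructor; [apply Hn|]; constructor; [apply (eProj 0 [x]); simpl; lia|constructor].
  - induction (n x) as [|m IH]; [constructor; apply Ha|].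
    apply ePrecS with (nrec m (a x) (h x)); [exact IH|].
    set (z := nrec m (a x) (h x)); change (nrec (S m) (a x) (h x)) with (h x m z).
    apply eComp with [pr x (pr m z)].
    + repeat constructor; apply eComp with [x; pr m z]; [|apply Hp].
      constructor; [apply (eProj 2 [m; z; x]); simpl; lia|].
      constructor; [|constructor].
      apply eComp with [m; z]; [|apply Hp].
      constructor; [apply (eProj 0 [m; z; x]); simpl; lia|].
      constructor; [apply (eProj 1 [m; z; x]); simpl; lia|constructor].
    + specialize (Hh (pr x (pr m z))); now rewrite !p1_pr, !p2_pr, p1_pr in Hh.
Qed.

Definition ifz (c a b : nat) : nat := match c with 0 => a | S _ => b end.

Lemma comp_ifz c a b : comp c -> comp a -> comp b -> comp (fun x => ifz (c x) (a x) (b x)).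
Proof.
  intros Hc Ha Hb.
  apply comp_ext with (fun x => (1 - c x) * a x + (1 - (1 - c x)) * b x).
  { intros x; destruct (c x); simpl ifz; lia. }
  auto using comp_add, comp_mul, comp_sub, comp_const.
Qed.

Definition nsum (n : nat) (f : nat -> nat) : nat := nrec n 0 (fun j y => y + f j).

Lemma comp_nsum n f : comp n -> comp (fun w => f (p1 w) (p2 w)) ->
  comp (fun x => nsum (n x) (f x)).
Proof.
  intros Hn Hf; apply (comp_nrec n (fun _ => 0) (fun x j y => y + f x j)); auto using comp_const.
  apply comp_add.
  - auto using comp_p2, comp_id.
  - assert (H : comp (fun w => pr (p1 w) (p1 (p2 w)))).
    { auto using comp_pr, comp_p1, comp_p2, comp_id. }
    apply comp_ext with (2 := comp_comp _ _ Hf H); intros x; cbv beta; now rewrite p1_pr, p2_pr.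
Qed.

(** Turns bounded universal quantification into arithmetic, so that conditions on finite metrics
    become the vanishing of a computable number. *)
Lemma nsum_eq0 n f : nsum n f = 0 <-> forall j, j < n -> f j = 0.
Proof.
  induction n as [|n IH]; unfold nsum in *; simpl; [split; intros; [lia|auto]|].
  rewrite Nat.eq_add_0, IH; split.
  - intros [H1 H2] j Hj; destruct (Nat.eq_dec j n); [now subst|apply H1; lia].
  - intros H; split; [intros j Hj; apply H; lia|apply H; lia].
Qed.

(* Rounded up quotient of [x] by [S y]. *)
Definition cdiv (x y : nat) : nat := (x + y) / S y.

(** The adjunction that characterizes rounding up; all later facts about [cdiv] go through it. *)
Lemma cdiv_spec x y c : cdiv x y <= c <-> x <= c * S y.
Proof.
  unfold cdiv; split; intros H.
  - generalize (Nat.mul_succ_div_gt (x + y) (S y)); nia.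
  - enough ((x + y) / S y < S c) by lia. apply Nat.Div0.div_lt_upper_bound; nia.
Qed.

Lemma comp_cdiv f g : comp f -> comp g -> comp (fun x => cdiv (f x) (g x)).
Proof.
  intros Hf Hg; apply comp_min with (fun c x => f x - c * S (g x)).
  - apply comp_sub; [|apply comp_mul; [|apply comp_S]]; auto using comp_p1, comp_id.
    + apply (comp_comp f); auto using comp_p2, comp_id.
    + apply (comp_comp g); auto using comp_p2, comp_id.
  - intros x; split.
    + enough (f x <= cdiv (f x) (g x) * S (g x)) by lia. now apply cdiv_spec.
    + intros m Hm H0; assert (cdiv (f x) (g x) <= m) by (apply cdiv_spec; lia); lia.
Qed.

Lemma computable2_comp f : comp (fun w => f (p1 w) (p2 w)) -> computable2 f.
Proof.
  intros [e He]; destruct computable2_pr as [ep Hp].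
  exists (RComp e [ep]); intros a b; apply eComp with [pr a b].
  - repeat constructor; apply Hp.
  - specialize (He (pr a b)); now rewrite p1_pr, p2_pr in He.
Qed.

Lemma computable3_comp f : comp (fun w => f (p1 w) (p1 (p2 w)) (p2 (p2 w))) -> computable3 f.
Proof.
  intros [e He]; destruct computable2_pr as [ep Hp].
  exists (RComp e [RComp ep [RProj 0; RComp ep [RProj 1; RProj 2]]]); intros a b c.
  apply eComp with [pr a (pr b c)].
  - repeat constructor; apply eComp with [a; pr b c]; [|apply Hp].
    constructor; [apply (eProj 0 [a; b; c]); simpl; lia|].
    constructor; [|constructor].
    apply eComp with [b; c]; [|apply Hp].
    constructor; [apply (eProj 1 [a; b; c]); simpl; lia|].
    constructor; [apply (eProj 2 [a; b; c]); simpl; lia|constructor].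
  - specialize (He (pr a (pr b c))); now rewrite !p1_pr, !p2_pr, p1_pr in He.
Qed.

Create HintDb comp discriminated.
#[local] Hint Constants Opaque : comp.
#[local] Hint Variables Opaque : comp.
#[local] Hint Resolve comp_const comp_id comp_S comp_pred comp_add comp_mul comp_sub comp_pr
  comp_p1 comp_p2 comp_ifz comp_cdiv comp_nsum comp_nrec : comp.
Ltac comp := auto 200 with comp nocore.

(** * A universal machine *)

(** The empty list is 0 and every other list a successor, so [ifz] tests emptiness. *)
Definition lcons (a l : nat) : nat := S (pr a l).
Definition lhd (l : nat) : nat := p1 (pred l).
Definition ltl (l : nat) : nat := p2 (pred l).

Definition lcode (l : list nat) : nat := fold_right lcons 0 l.

Fixpoint code (e : recf) : nat :=
  match e with
  | RZero => pr 0 0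
  | RSucc => pr 1 0
  | RProj i => pr 2 i
  | RComp f gs => pr 3 (pr (code f) (lcode (map code gs)))
  | RPrec f g => pr 4 (pr (code f) (code g))
  | RMin f => pr 5 (code f)
  end.

(* A machine state [st mode a b k] has a stack [k] of pending frames. Mode 0 evaluates the
   function coded by [a] on the arguments [b], mode 1 evaluates the list [a] of functions on [b],
   and mode 2 hands the value [a] over to the top frame. The frames are [pr 0 f] (apply f to the
   value), [pr 1 _] and [pr 2 _] (continue a recursion, a minimization), [pr 3 _] (evaluate the
   rest of a list of functions) and [pr 4 y] (prepend y to the value). *)
Definition st (mode a b k : nat) : nat := pr mode (pr a (pr b k)).

(** Nested predecessors distinguish the tag [p1 c]. A projection drops one argument per step, a
    recursion first evaluates itself at the predecessor, a minimization starts with the candidate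
    0. *)
Definition step_fun (c v k : nat) : nat :=
  ifz (p1 c) (st 2 0 0 k)
  (ifz (pred (p1 c)) (st 2 (S (lhd v)) 0 k)
  (ifz (pred (pred (p1 c)))
     (ifz (p2 c) (st 2 (lhd v) 0 k) (st 0 (pr 2 (pred (p2 c))) (ltl v) k))
  (ifz (pred (pred (pred (p1 c))))
     (st 1 (p2 (p2 c)) v (lcons (pr 0 (p1 (p2 c))) k))
  (ifz (pred (pred (pred (pred (p1 c)))))
     (ifz (lhd v)
        (st 0 (p1 (p2 c)) (ltl v) k)
        (st 0 c (lcons (pred (lhd v)) (ltl v))
           (lcons (pr 1 (pr (p2 (p2 c)) (pr (pred (lhd v)) (ltl v)))) k)))
     (st 0 (p2 c) (lcons 0 v) (lcons (pr 2 (pr (p2 c) (pr 0 v))) k)))))).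

Definition step_list (gs v k : nat) : nat :=
  ifz gs (st 2 0 0 k) (st 0 (lhd gs) v (lcons (pr 3 (pr (ltl gs) v)) k)).

Definition step_frame (y t d k : nat) : nat :=
  ifz t (st 0 d y k)
  (ifz (pred t) (st 0 (p1 d) (lcons (p1 (p2 d)) (lcons y (p2 (p2 d)))) k)
  (ifz (pred (pred t))
     (ifz y (st 2 (p1 (p2 d)) 0 k)
        (st 0 (p1 d) (lcons (S (p1 (p2 d))) (p2 (p2 d)))
           (lcons (pr 2 (pr (p1 d) (pr (S (p1 (p2 d))) (p2 (p2 d))))) k)))
  (ifz (pred (pred (pred t)))
     (st 1 (p1 d) (p2 d) (lcons (pr 4 y) k))
     (st 2 (lcons d y) 0 k)))).

(** On an empty stack the value is kept, so a halted computation stays readable at all later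
    times. *)
Definition step_ret (y k : nat) : nat :=
  ifz k (st 2 y 0 0) (step_frame y (p1 (lhd k)) (p2 (lhd k)) (ltl k)).

Definition step (s : nat) : nat :=
  ifz (p1 s) (step_fun (p1 (p2 s)) (p1 (p2 (p2 s))) (p2 (p2 (p2 s))))
  (ifz (pred (p1 s)) (step_list (p1 (p2 s)) (p1 (p2 (p2 s))) (p2 (p2 (p2 s))))
     (step_ret (p1 (p2 s)) (p2 (p2 (p2 s))))).

Lemma comp_step s : comp s -> comp (fun x => step (s x)).
Proof.
  intros Hs; apply (comp_comp step); [|exact Hs].
  unfold step, step_ret, step_frame, step_list, step_fun, st, lhd, ltl, lcons; comp.
Qed.

Definition run (n s : nat) : nat := nrec n s (fun _ => step).

Lemma run_add n m s : run (n + m) s = run n (run m s).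
Proof. induction n as [|n IH]; [reflexivity|]. unfold run in *; simpl; now rewrite IH. Qed.

Definition reach (s s' : nat) : Prop := exists n, run n s = s'.

Lemma reach_trans s s' s'' : reach s s' -> reach s' s'' -> reach s s''.
Proof. intros [n Hn] [m Hm]; exists (m + n); now rewrite run_add, Hn. Qed.

Lemma step_reach s s' s'' : step s = s' -> reach s' s'' -> reach s s''.
Proof. intros H; apply reach_trans; now exists 1. Qed.

Lemma reach_refl s : reach s s.
Proof. now exists 0. Qed.

Ltac machine_simpl :=
  unfold step, step_ret, step_fun, step_list, step_frame, st, lhd, ltl, lcons;
  repeat (rewrite ?p1_pr, ?p2_pr; simpl).

Ltac machine := eapply step_reach; [machine_simpl; reflexivity|].

(** Mutual induction on the evaluation. The arbitrary stack [k] lets the induction hypotheses run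
    subcomputations below pending frames. *)
Lemma reach_eval : forall e v y, eval e v y ->
    forall k, reach (st 0 (code e) (lcode v) k) (st 2 y 0 k)
with reach_evals : forall gs v ws, evals gs v ws ->
    forall k, reach (st 1 (lcode (map code gs)) (lcode v) k) (st 2 (lcode ws) 0 k).
Proof.
  - intros e v y [v0|x v0|i v0 Hi|f gs v0 ws y0 Hgs Hf|f g v0 y0 Hf|f g n v0 z y0 Hz Hg
                 |f v0 n H0 Hlt] k.
    + machine; apply reach_refl.
    + machine; apply reach_refl.
    + revert v0 Hi; induction i as [|i IH]; intros [|x v0] Hi; simpl in Hi; try lia.
      * machine; apply reach_refl.
      * machine; apply (IH v0); lia.
    + machine; eapply reach_trans; [apply (reach_evals _ _ _ Hgs)|].
      machine; apply (reach_eval _ _ _ Hf).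
    + machine; apply (reach_eval _ _ _ Hf).
    + machine; eapply reach_trans; [apply (reach_eval _ _ _ Hz)|].
      machine; apply (reach_eval _ _ _ Hg).
    (* Induction on the number [j] of candidates still to be refuted before the least zero [n]. *)
    + assert (Hm : forall j m, j + m = n -> reach
          (st 0 (code f) (lcode (m :: v0))
              (lcons (pr 2 (pr (code f) (pr m (lcode v0)))) k)) (st 2 n 0 k)).
      { induction j as [|j IH]; intros m Hjm.
        - replace m with n by lia.
          eapply reach_trans; [apply (reach_eval _ _ _ H0)|].
          machine; apply reach_refl.
        - assert (Hmn : m < n) by lia.
          destruct (Hlt m Hmn) as [r Hr].
          eapply reach_trans; [apply (reach_eval _ _ _ Hr)|].
          machine; apply (IH (S m)); lia. }
      machine; apply (Hm n 0); lia.
  - intros gs v ws [v0|g gs0 v0 y ys Hg Hgs] k.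
    + machine; apply reach_refl.
    + machine; eapply reach_trans; [apply (reach_eval _ _ _ Hg)|].
      machine; eapply reach_trans; [apply (reach_evals _ _ _ Hgs)|].
      machine; apply reach_refl.
Qed.

Definition readout (s : nat) : nat :=
  ifz (2 - p1 s) (ifz (p2 (p2 (p2 s))) (S (p1 (p2 s))) 0) 0.

(* [0] if the function number [e] has not halted on [x] after [n] steps, else [S] of its value. *)
Definition univ (e x n : nat) : nat := readout (run n (st 0 e (lcons x 0) 0)).

Lemma comp_univ e x n : comp e -> comp x -> comp n -> comp (fun w => univ (e w) (x w) (n w)).
Proof.
  intros He Hx Hn; apply (comp_comp readout).
  - unfold readout; comp.
  - unfold run, st, lcons; apply (comp_nrec n _ (fun _ _ => step)); comp.
    apply comp_step; comp.
Qed.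

Lemma univ_universal f : comp f ->
  exists e, forall x, exists n0, forall n, n0 <= n -> univ e x n = S (f x).
Proof.
  intros [e He]; exists (code e); intros x.
  destruct (reach_eval _ _ _ (He x) 0) as [n0 Hn0]; exists n0; intros n Hn.
  unfold univ; simpl in Hn0.
  replace n with ((n - n0) + n0) by lia; rewrite run_add, Hn0.
  assert (Hr : forall m, run m (st 2 (f x) 0 0) = st 2 (f x) 0 0).
  { induction m as [|m IH]; [reflexivity|].
    change (step (run m (st 2 (f x) 0 0)) = st 2 (f x) 0 0).
    rewrite IH; machine_simpl; reflexivity. }
  rewrite Hr; unfold readout, st; rewrite !p1_pr, !p2_pr, p1_pr; reflexivity.
Qed.

(** Holds for every number [e], even one that codes no function: a nonzero readout means mode at
    least 2 and an empty stack, where [step] preserves the value. *)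
Lemma univ_stable e x n m : univ e x n <> 0 -> n <= m -> univ e x m = univ e x n.
Proof.
  intros Hn; induction 1 as [|m _ IH]; [reflexivity|].
  rewrite <- IH in *; clear IH; revert Hn; unfold univ.
  change (run (S m) (st 0 e (lcons x 0) 0)) with (step (run m (st 0 e (lcons x 0) 0))).
  generalize (run m (st 0 e (lcons x 0) 0)); intros s; unfold readout at 1 3.
  destruct (2 - p1 s) eqn:E1; simpl; [|easy].
  destruct (p2 (p2 (p2 s))) eqn:E2; simpl; [intros _|easy].
  unfold step; destruct (p1 s) as [|[|c]]; [discriminate|discriminate|].
  simpl; rewrite E2; simpl; unfold readout, st; rewrite !p1_pr, !p2_pr, p1_pr; reflexivity.
Qed.

#[local] Hint Resolve comp_univ : comp.

(** * Stages of the uniform construction *)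

(* A stage [z = pr n (pr t (pr m T))] proposes a metric on the points [0 .. n-1], read off the
   [t]-th rational lower bounds num/(S den) computed by the function number [e] within [T] steps:
   the distance of [i] and [k] is [mat e z i k / S (scale z)]. *)
Definition zn (z : nat) : nat := p1 z.
Definition zt (z : nat) : nat := p1 (p2 z).
Definition zm (z : nat) : nat := p1 (p2 (p2 z)).

Definition entry (e z i k : nat) : nat := univ e (pr i (pr k (zt z))) (p2 (p2 (p2 z))).
Definition num (e z i k : nat) : nat := p1 (pred (entry e z i k)).
Definition den (e z i k : nat) : nat := p2 (pred (entry e z i k)).
(** With [n = zn z] and [m = zm z], the lower bounds are shrunk by the factor [n / (n + 1)] and
    rounded up to multiples of [1 / ((n + 1) * (m + 1))]; [S (scale z)] is this denominator. *)
Definition mat (e z i k : nat) : nat := cdiv (zn z * S (zm z) * num e z i k) (den e z i k).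
Definition scale (z : nat) : nat := zm z + zn z * S (zm z).

Lemma comp_zn z : comp z -> comp (fun x => zn (z x)).
Proof. unfold zn; comp. Qed.
Lemma comp_zt z : comp z -> comp (fun x => zt (z x)).
Proof. unfold zt; comp. Qed.
Lemma comp_zm z : comp z -> comp (fun x => zm (z x)).
Proof. unfold zm; comp. Qed.
#[local] Hint Resolve comp_zn comp_zt comp_zm : comp.

Lemma comp_entry e z i k : comp e -> comp z -> comp i -> comp k ->
  comp (fun x => entry (e x) (z x) (i x) (k x)).
Proof. unfold entry; comp. Qed.
#[local] Hint Resolve comp_entry : comp.
Lemma comp_num e z i k : comp e -> comp z -> comp i -> comp k ->
  comp (fun x => num (e x) (z x) (i x) (k x)).
Proof. unfold num; comp. Qed.
Lemma comp_den e z i k : comp e -> comp z -> comp i -> comp k ->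
  comp (fun x => den (e x) (z x) (i x) (k x)).
Proof. unfold den; comp. Qed.
#[local] Hint Resolve comp_num comp_den : comp.
Lemma comp_mat e z i k : comp e -> comp z -> comp i -> comp k ->
  comp (fun x => mat (e x) (z x) (i x) (k x)).
Proof. unfold mat; comp. Qed.
Lemma comp_scale z : comp z -> comp (fun x => scale (z x)).
Proof. unfold scale; comp. Qed.
#[local] Hint Resolve comp_mat comp_scale : comp.

Section Stages.
Context (gn gd : nat -> nat) (comp_gn0 : comp gn) (comp_gd0 : comp gd).

Lemma comp_gn f : comp f -> comp (fun x => gn (f x)).
Proof. now apply comp_comp. Qed.
Lemma comp_gd f : comp f -> comp (fun x => gd (f x)).
Proof. now apply comp_comp. Qed.
#[local] Hint Resolve comp_gn comp_gd : comp.

(* Vanishes iff the stage [z] can succeed the stage [z0] (see [defect_eq0]). *)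
Definition defect (e z0 z : nat) : nat :=
  nsum (zn z) (fun i => nsum (zn z) (fun k =>
    (1 - entry e z i k) + mat e z i i + (mat e z i k - mat e z k i)
    + (mat e z i k * (S (S (zn z)) * S (den e z i k)) - S (zn z) * num e z i k * S (scale z))
    + (mat e z i k * S (gd (zt z)) - gn (zt z) * S (scale z))
    + nsum (zn z) (fun j => mat e z i k - (mat e z i j + mat e z j k))))
  + nsum (zn z0) (fun i => nsum (zn z0) (fun k =>
      mat e z0 i k * S (scale z) - mat e z i k * S (scale z0)))
  + (zn z - zt z).

Lemma comp_defect e z0 z : comp e -> comp z0 -> comp z ->
  comp (fun x => defect (e x) (z0 x) (z x)).
Proof.
  intros He Hz0 Hz; unfold defect.
  pose proof (fun f => comp_comp e f He) as He'.
  pose proof (fun f => comp_comp z f Hz) as Hz'.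
  pose proof (fun f => comp_comp z0 f Hz0) as Hz0'.
  comp.
Qed.

(** The loop counter [j] itself codes the triple of parameters on trial, so each round tests one
    candidate with exactly one more point. *)
Definition stage (e s : nat) : nat :=
  nrec s (pr 0 0) (fun j z => ifz (defect e z (pr (S (zn z)) j)) (pr (S (zn z)) j) z).

(** Distances to points not yet accepted count as 0, which keeps the approximations
    nondecreasing. *)
Definition rnum (e s i k : nat) : nat :=
  ifz (S i - zn (stage e s)) (ifz (S k - zn (stage e s)) (mat e (stage e s) i k) 0) 0.

(* The special point [pr e (pr i s)] is the point [i] of the component [e] if this point has
   appeared by stage [s], and the point [0] of that component otherwise. *)
Definition idx (p : nat) : nat :=
  ifz (S (p1 (p2 p)) - zn (stage (p1 p) (p2 (p2 p)))) (p1 (p2 p)) 0.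

Definition apart (a b : nat) : nat := (a - b) + (b - a).

Definition anum (p q t : nat) : nat :=
  ifz (apart (p1 p) (p1 q)) (rnum (p1 p) t (idx p) (idx q)) (gn t).
Definition aden (p q t : nat) : nat :=
  ifz (apart (p1 p) (p1 q)) (scale (stage (p1 p) t)) (gd t).

Lemma comp_stage e s : comp e -> comp s -> comp (fun x => stage (e x) (s x)).
Proof.
  intros He Hs; unfold stage.
  pose proof (fun f => comp_comp e f He) as He'.
  pose proof comp_defect as Hd.
  apply (comp_nrec s (fun _ => pr 0 0) (fun x j z =>
    ifz (defect (e x) z (pr (S (zn z)) j)) (pr (S (zn z)) j) z)); comp.
Qed.
#[local] Hint Resolve comp_stage : comp.

Lemma comp_idx p : comp p -> comp (fun x => idx (p x)).
Proof. unfold idx; comp. Qed.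
#[local] Hint Resolve comp_idx : comp.

Lemma computable3_anum : computable3 anum.
Proof. apply computable3_comp; unfold anum, rnum, apart; comp. Qed.

Lemma computable3_aden : computable3 aden.
Proof. apply computable3_comp; unfold aden, apart; comp. Qed.

Local Open Scope R_scope.

(** * Rational codes and correctness of the stage test *)

Definition frac (a b : nat) : R := INR a / INR (S b).

Lemma ratcode_frac a b : ratcode a 0 b = frac a b.
Proof. unfold ratcode, frac; rewrite S_INR; simpl INR; now rewrite Rminus_0_r. Qed.

Lemma INR_S_pos n : 0 < INR (S n).
Proof. apply lt_0_INR; lia. Qed.

Lemma frac_nonneg a b : 0 <= frac a b.
Proof. apply Rle_mult_inv_pos; [apply pos_INR|apply INR_S_pos]. Qed.

Lemma Rdiv_le_cross a b c d : 0 < b -> 0 < d -> a / b <= c / d <-> a * d <= c * b.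
Proof.
  intros Hb Hd; replace a with ((a / b) * b) at 2 by (field; lra).
  replace c with ((c / d) * d) at 2 by (field; lra).
  split; intros H.
  - replace (c / d * d * b) with (c / d * b * d) by ring.
    apply Rmult_le_compat_r; [lra|]; apply Rmult_le_compat_r; lra.
  - apply Rmult_le_reg_r with (b * d); [now apply Rmult_lt_0_compat|].
    lra.
Qed.

Lemma frac_le a b c d : frac a b <= frac c d <-> (a * S d - c * S b = 0)%nat.
Proof.
  unfold frac; rewrite Rdiv_le_cross by apply INR_S_pos; rewrite <- !mult_INR; split; intros H.
  - apply INR_le in H; lia.
  - apply le_INR; lia.
Qed.

Lemma frac_le_mul a b c d c' d' :
  frac a b <= frac c d * frac c' d' <-> (a * (S d * S d') - c * c' * S b = 0)%nat.
Proof.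
  replace (frac c d * frac c' d') with (INR (c * c') / INR (S d * S d')).
  2: { unfold frac; rewrite !mult_INR; field; split; apply Rgt_not_eq, INR_S_pos. }
  unfold frac; rewrite Rdiv_le_cross; [|apply INR_S_pos|apply lt_0_INR; lia].
  rewrite <- !mult_INR; split; intros H.
  - apply INR_le in H; lia.
  - apply le_INR; lia.
Qed.

Lemma mul_frac_le a b c d : INR a * frac b c <= INR d <-> (a * b <= d * S c)%nat.
Proof.
  replace (INR a * frac b c) with (INR (a * b) / INR (S c)).
  2: { unfold frac; rewrite mult_INR; field; apply Rgt_not_eq, INR_S_pos. }
  replace (INR d) with (INR d / 1) by field.
  rewrite Rdiv_le_cross; [|apply INR_S_pos|lra].
  rewrite Rmult_1_r, <- mult_INR; split; intros H; [now apply INR_le|now apply le_INR].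
Qed.

Definition low (e z i k : nat) : R := frac (num e z i k) (den e z i k).
Definition md (e z i k : nat) : R := frac (mat e z i k) (scale z).
Definition gq (t : nat) : R := frac (gn t) (gd t).

Lemma mat_le_iff e z i k c :
  (mat e z i k <= c)%nat <-> INR (zn z * S (zm z)) * low e z i k <= INR c.
Proof. unfold mat, low; rewrite cdiv_spec, mul_frac_le; reflexivity. Qed.

Lemma scale_INR z : INR (S (scale z)) = INR (S (zn z)) * INR (S (zm z)).
Proof. rewrite <- mult_INR; f_equal; unfold scale; lia. Qed.

(** Rounding up never loses anything, so an adopted metric stays close to its lower bounds; this
    forces convergence in [D_cv]. *)
Lemma low_le_md e z i k : frac (zn z) (zn z) * low e z i k <= md e z i k.
Proof.
  assert (H := proj1 (mat_le_iff e z i k _) (le_n _)).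
  assert (P1 := INR_S_pos (zn z)); assert (P2 := INR_S_pos (zm z)).
  replace (md e z i k) with (INR (mat e z i k) / (INR (S (zn z)) * INR (S (zm z))))
    by (unfold md, frac; now rewrite scale_INR).
  apply Rmult_le_reg_r with (INR (S (zn z)) * INR (S (zm z))); [now apply Rmult_lt_0_compat|].
  replace (INR (mat e z i k) / (INR (S (zn z)) * INR (S (zm z)))
           * (INR (S (zn z)) * INR (S (zm z)))) with (INR (mat e z i k)) by (field; lra).
  eapply Rle_trans; [|exact H]; apply Req_le; rewrite mult_INR; unfold frac; field; lra.
Qed.

(** The factor in [ok_low] is the shrinking factor of the next size [S (zn z)], which leaves room
    for a successor stage to dominate this one. [ok_time] makes the sampling index grow with the
    number of points. *)
Record stage_ok (e z : nat) : Prop := {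
  ok_halt : forall i k, (i < zn z)%nat -> (k < zn z)%nat -> entry e z i k <> 0%nat;
  ok_diag : forall i, (i < zn z)%nat -> mat e z i i = 0%nat;
  ok_sym : forall i k, (i < zn z)%nat -> (k < zn z)%nat -> mat e z i k = mat e z k i;
  ok_tri : forall i j k, (i < zn z)%nat -> (j < zn z)%nat -> (k < zn z)%nat ->
    (mat e z i k <= mat e z i j + mat e z j k)%nat;
  ok_low : forall i k, (i < zn z)%nat -> (k < zn z)%nat ->
    md e z i k <= frac (S (zn z)) (S (zn z)) * low e z i k;
  ok_diam : forall i k, (i < zn z)%nat -> (k < zn z)%nat -> md e z i k <= gq (zt z);
  ok_time : (zn z <= zt z)%nat }.

Definition stage_le (e z0 z : nat) : Prop :=
  forall i k, (i < zn z0)%nat -> (k < zn z0)%nat -> md e z0 i k <= md e z i k.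

Lemma defect_eq0 e z0 z : defect e z0 z = 0%nat <-> stage_ok e z /\ stage_le e z0 z.
Proof.
  unfold defect; rewrite !Nat.eq_add_0, !nsum_eq0; split.
  - intros [[H1 H2] H3].
    assert (H := fun i k Hi => proj1 (nsum_eq0 _ _) (H1 i Hi) k); cbv beta in H.
    split; [split|].
    + intros i k Hi Hk; generalize (H i k Hi Hk); lia.
    + intros i Hi; generalize (H i i Hi Hi); lia.
    + intros i k Hi Hk; generalize (H i k Hi Hk) (H k i Hk Hi); lia.
    + intros i j k Hi Hj Hk; generalize (H i k Hi Hk); rewrite !Nat.eq_add_0, nsum_eq0.
      intros [_ Ht]; specialize (Ht j Hj); cbv beta in Ht; lia.
    + intros i k Hi Hk; apply frac_le_mul; generalize (H i k Hi Hk); lia.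
    + intros i k Hi Hk; apply frac_le; generalize (H i k Hi Hk); lia.
    + lia.
    + intros i k Hi Hk; apply frac_le; generalize (H2 i Hi); rewrite nsum_eq0.
      intros Hm; exact (Hm k Hk).
  - intros [[H1 H2 H3 H4 H5 H6 H7] H8]; repeat split; [| |lia].
    + intros i Hi; rewrite nsum_eq0; intros k Hk; rewrite !Nat.eq_add_0, nsum_eq0.
      repeat split.
      * specialize (H1 i k Hi Hk); lia.
      * auto.
      * rewrite (H3 i k Hi Hk); lia.
      * apply frac_le_mul, H5; auto.
      * apply frac_le, H6; auto.
      * intros j Hj; specialize (H4 i j k Hi Hj Hk); lia.
    + intros i Hi; rewrite nsum_eq0; intros k Hk; apply frac_le, H8; auto.
Qed.

(** * The increasing stages and their partial metrics *)

Lemma stage_0 e : stage e 0 = pr 0 0.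
Proof. reflexivity. Qed.

Lemma stage_S e s :
  stage e (S s) = ifz (defect e (stage e s) (pr (S (zn (stage e s))) s))
                      (pr (S (zn (stage e s))) s) (stage e s).
Proof. reflexivity. Qed.

Lemma stage_succ e s (z := pr (S (zn (stage e s))) s) :
  stage_ok e z -> stage_le e (stage e s) z -> stage e (S s) = z.
Proof.
  intros H1 H2; rewrite stage_S; fold z.
  now rewrite (proj2 (defect_eq0 e (stage e s) z) (conj H1 H2)).
Qed.

Lemma zn_pr n s : zn (pr n s) = n.
Proof. apply p1_pr. Qed.

Lemma stage_cases e s : stage e (S s) = stage e s \/
  stage_ok e (stage e (S s)) /\ stage_le e (stage e s) (stage e (S s)) /\
  zn (stage e (S s)) = S (zn (stage e s)).
Proof.
  rewrite stage_S; set (z := pr (S (zn (stage e s))) s).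
  destruct (defect e (stage e s) z) eqn:E; simpl; [right|now left].
  apply defect_eq0 in E as [H1 H2]; repeat split; auto; apply H1 || apply zn_pr.
Qed.

Lemma stage_ok_all e s : stage_ok e (stage e s).
Proof.
  induction s as [|s IH].
  - rewrite stage_0; split; rewrite zn_pr; intros; lia.
  - destruct (stage_cases e s) as [-> | [H _]]; assumption.
Qed.

Lemma zn_stage_mono e s t : (s <= t)%nat -> (zn (stage e s) <= zn (stage e t))%nat.
Proof.
  induction 1 as [|t _ IH]; [lia|].
  destruct (stage_cases e t) as [-> | [_ [_ H]]]; lia.
Qed.

Lemma stage_fixed e s t : (s <= t)%nat -> (zn (stage e t) <= zn (stage e s))%nat ->
  stage e t = stage e s.
Proof.
  induction 1 as [|t Hst IH]; [reflexivity|].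
  destruct (stage_cases e t) as [-> | [_ [_ H]]]; [exact IH|].
  intros Hle; generalize (zn_stage_mono e s t Hst); lia.
Qed.

Definition D (e s i k : nat) : R := frac (rnum e s i k) (scale (stage e s)).

Lemma frac_0 b : frac 0 b = 0.
Proof. unfold frac; simpl INR at 1; apply Rdiv_0_l. Qed.

Lemma D_cases e s i k :
  (i < zn (stage e s))%nat /\ (k < zn (stage e s))%nat /\ D e s i k = md e (stage e s) i k \/
  (zn (stage e s) <= i \/ zn (stage e s) <= k)%nat /\ rnum e s i k = 0%nat /\ D e s i k = 0.
Proof.
  unfold D, rnum.
  destruct (S i - zn (stage e s))%nat eqn:E1; cbn [ifz]; [|right; rewrite frac_0; repeat split; lia].
  destruct (S k - zn (stage e s))%nat eqn:E2; cbn [ifz]; [|right; rewrite frac_0; repeat split; lia].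
  left; repeat split; lia.
Qed.

Lemma D_active e s i k : (i < zn (stage e s))%nat -> (k < zn (stage e s))%nat ->
  D e s i k = md e (stage e s) i k.
Proof. destruct (D_cases e s i k) as [[_ [_ H]]|[H _]]; [auto|lia]. Qed.

Lemma D_nonneg e s i k : 0 <= D e s i k.
Proof. apply frac_nonneg. Qed.

Lemma D_diag e s i : D e s i i = 0.
Proof.
  destruct (D_cases e s i i) as [[H [_ ->]]|[_ [_ H]]]; [|exact H].
  unfold md; rewrite (ok_diag _ _ (stage_ok_all e s) i H); apply frac_0.
Qed.

Lemma D_sym e s i k : D e s i k = D e s k i.
Proof.
  destruct (D_cases e s i k) as [[H1 [H2 ->]]|[H [_ ->]]].
  - rewrite D_active by assumption; unfold md.
    now rewrite (ok_sym _ _ (stage_ok_all e s) i k H1 H2).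
  - destruct (D_cases e s k i) as [H'|[_ [_ ->]]]; [lia|reflexivity].
Qed.

Lemma frac_add a b c : frac (a + b) c = frac a c + frac b c.
Proof. unfold frac; rewrite plus_INR; field; apply Rgt_not_eq, INR_S_pos. Qed.

(** An inactive [j] has distance 0 to everything and could break the inequality between active
    points; if no point is active, all distances vanish. *)
Lemma D_tri e s i j k : (j < zn (stage e s) \/ zn (stage e s) = 0)%nat ->
  D e s i k <= D e s i j + D e s j k.
Proof.
  intros Hj; destruct (D_cases e s i k) as [[H1 [H2 ->]]|[H [_ ->]]].
  - rewrite !D_active by lia; unfold md; rewrite <- frac_add; apply frac_le.
    enough (mat e (stage e s) i k <= mat e (stage e s) i j + mat e (stage e s) j k)%nat by nia.
    apply (ok_tri _ _ (stage_ok_all e s)); lia.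
  - generalize (D_nonneg e s i j) (D_nonneg e s j k); lra.
Qed.

Lemma D_growing e i k : Un_growing (fun s => D e s i k).
Proof.
  intros s; destruct (D_cases e s i k) as [[H1 [H2 ->]]|[_ [_ ->]]]; [|apply D_nonneg].
  rewrite D_active by (eapply Nat.lt_le_trans; [eassumption|apply zn_stage_mono; lia]).
  destruct (stage_cases e s) as [-> | [_ [H _]]]; [lra|now apply H].
Qed.

(** * The limit pseudometric and the universal space *)

Context (gamma : R) (gq_growing : Un_growing gq) (gq_cv : Un_cv gq gamma).

Lemma gq_le t : gq t <= gamma.
Proof. now apply growing_ineq. Qed.

Lemma gamma_nonneg : 0 <= gamma.
Proof. eapply Rle_trans; [apply (frac_nonneg (gn 0) (gd 0))|apply (gq_le 0)]. Qed.

Lemma D_le_gamma e s i k : D e s i k <= gamma.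
Proof.
  destruct (D_cases e s i k) as [[H1 [H2 ->]]|[_ [_ ->]]]; [|apply gamma_nonneg].
  eapply Rle_trans; [apply (ok_diam _ _ (stage_ok_all e s)); assumption|apply gq_le].
Qed.

Definition approx (p q t : nat) : R := frac (anum p q t) (aden p q t).

Lemma approx_same p q : p1 p = p1 q -> forall t, approx p q t = D (p1 p) t (idx p) (idx q).
Proof.
  intros H t; unfold approx, anum, aden, apart; rewrite <- H, Nat.sub_diag; reflexivity.
Qed.

Lemma approx_apart p q : p1 p <> p1 q -> forall t, approx p q t = gq t.
Proof.
  intros H t; unfold approx, anum, aden.
  destruct (apart (p1 p) (p1 q)) eqn:E; [unfold apart in E; lia|reflexivity].
Qed.

Lemma approx_growing p q : Un_growing (approx p q).
Proof.
  destruct (Nat.eq_dec (p1 p) (p1 q)) as [H|H]; intros t.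
  - rewrite !approx_same by assumption; apply D_growing.
  - rewrite !approx_apart by assumption; apply gq_growing.
Qed.

Lemma approx_le p q t : approx p q t <= gamma.
Proof.
  destruct (Nat.eq_dec (p1 p) (p1 q)) as [H|H].
  - rewrite approx_same by assumption; apply D_le_gamma.
  - rewrite approx_apart by assumption; apply gq_le.
Qed.

Lemma approx_has_ub p q : has_ub (approx p q).
Proof. exists gamma; intros x [t ->]; apply approx_le. Qed.

Definition pdist (p q : nat) : R :=
  proj1_sig (growing_cv _ (approx_growing p q) (approx_has_ub p q)).

Lemma pdist_cv p q : Un_cv (approx p q) (pdist p q).
Proof. unfold pdist; now destruct growing_cv. Qed.

Lemma pdist_unique p q l : Un_cv (approx p q) l -> pdist p q = l.
Proof. apply UL_sequence, pdist_cv. Qed.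

Lemma pdist_le p q : pdist p q <= gamma.
Proof.
  apply Rle_cv_lim with (approx p q) (fun _ => gamma).
  - apply approx_le.
  - apply pdist_cv.
  - apply Un_cv_const.
Qed.

Lemma approx_le_pdist p q t : approx p q t <= pdist p q.
Proof. apply growing_ineq; [apply approx_growing|apply pdist_cv]. Qed.

Lemma pdist_apart p q : p1 p <> p1 q -> pdist p q = gamma.
Proof.
  intros H; apply pdist_unique; intros eps He; destruct (gq_cv eps He) as [N HN].
  exists N; intros n Hn; rewrite approx_apart by assumption; now apply HN.
Qed.

Lemma pdist_diag p : pdist p p = 0.
Proof.
  apply pdist_unique; intros eps He; exists 0%nat; intros n _.
  rewrite approx_same, D_diag by reflexivity; rewrite Rdist_eq; exact He.
Qed.

Lemma pdist_sym p q : pdist p q = pdist q p.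
Proof.
  apply pdist_unique; intros eps He; destruct (pdist_cv q p eps He) as [N HN].
  exists N; intros n Hn; specialize (HN n Hn).
  destruct (Nat.eq_dec (p1 p) (p1 q)) as [H|H].
  - rewrite approx_same in * by congruence; rewrite D_sym, H; exact HN.
  - rewrite approx_apart in * by congruence; exact HN.
Qed.

(** This is what the stage stored in a special point is for: from then on its index is accepted. The
    fallback index 0 is accepted as soon as any point is. *)
Lemma idx_active p t : (p2 (p2 p) <= t)%nat ->
  (idx p < zn (stage (p1 p) t) \/ zn (stage (p1 p) t) = 0)%nat.
Proof.
  intros Ht; generalize (zn_stage_mono (p1 p) _ _ Ht); unfold idx.
  destruct (S (p1 (p2 p)) - zn (stage (p1 p) (p2 (p2 p))))%nat eqn:E; simpl; lia.
Qed.

Lemma pdist_tri p r q : pdist p q <= pdist p r + pdist r q.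
Proof.
  assert (Hn : forall a b, 0 <= pdist a b).
  { intros a b; eapply Rle_trans; [apply (frac_nonneg (anum a b 0))|apply approx_le_pdist]. }
  (* If [r] lies in another component than [p] or [q], one term on the right is [gamma], which
     bounds every distance. *)
  destruct (Nat.eq_dec (p1 p) (p1 r)) as [H1|H1].
  2: { rewrite (pdist_apart p r H1); generalize (pdist_le p q) (Hn r q); lra. }
  destruct (Nat.eq_dec (p1 r) (p1 q)) as [H2|H2].
  2: { rewrite (pdist_apart r q H2); generalize (pdist_le p q) (Hn p r); lra. }
  apply Rle_eps; intros eps He; destruct (pdist_cv p q eps He) as [N HN].
  (* Late enough both for the approximation of [pdist p q] and for the index of [r] to be active. *)
  set (t := max N (p2 (p2 r))); specialize (HN t ltac:(lia)).
  generalize (approx_le_pdist p r t) (approx_le_pdist r q t); revert HN.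
  rewrite !approx_same by congruence; rewrite <- H1.
  assert (Ht := D_tri (p1 p) t (idx p) (idx r) (idx q)).
  rewrite H1 in Ht at 1 2; specialize (Ht (idx_active r t ltac:(lia))).
  unfold Rdist, Rabs; destruct Rcase_abs; lra.
Qed.

Definition universal : PolishSpace :=
  completion pdist gamma pdist_diag pdist_sym pdist_tri pdist_le.

Lemma universal_dist p q : dist universal (pts universal p) (pts universal q) = pdist p q.
Proof. apply supdist_cpt. Qed.

Lemma universal_left_ce : left_ce_space universal.
Proof.
  exists anum, (fun _ _ _ => 0%nat), aden; split; [exact computable3_anum|].
  split; [apply computable3_comp; comp|]; split; [exact computable3_aden|].
  intros q i k; split.
  - intros s; unfold q; rewrite !ratcode_frac; apply approx_growing.
  - rewrite universal_dist; intros eps He; destruct (pdist_cv i k eps He) as [N HN].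
    exists N; intros n Hn; unfold q; rewrite ratcode_frac; now apply HN.
Qed.

Lemma universal_diam : diam_le universal gamma.
Proof. apply diam_le_pts; intros i k; rewrite universal_dist; apply pdist_le. Qed.

(** * Universality *)

Definition ev (P : nat -> Prop) : Prop := exists N, forall n, (N <= n)%nat -> P n.

Lemma ev_and P Q : ev P -> ev Q -> ev (fun n => P n /\ Q n).
Proof.
  intros [N HN] [K HK]; exists (max N K); intros n Hn; split; [apply HN|apply HK]; lia.
Qed.

Lemma ev_imp (P Q : nat -> Prop) : (forall n, P n -> Q n) -> ev P -> ev Q.
Proof. intros H [N HN]; exists N; auto. Qed.

Lemma ev_all (P : nat -> nat -> Prop) n :
  (forall i, (i < n)%nat -> ev (P i)) -> ev (fun t => forall i, (i < n)%nat -> P i t).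
Proof.
  induction n as [|n IH]; intros H; [exists 0%nat; intros; lia|].
  apply ev_imp with (2 := ev_and _ _ (IH ltac:(auto)) (H n ltac:(lia))).
  intros t [H1 H2] i Hi; destruct (Nat.eq_dec i n) as [->|]; [exact H2|apply H1; lia].
Qed.

Lemma ev_all2 (P : nat -> nat -> nat -> Prop) n :
  (forall i k, (i < n)%nat -> (k < n)%nat -> ev (P i k)) ->
  ev (fun t => forall i k, (i < n)%nat -> (k < n)%nat -> P i k t).
Proof.
  intros H.
  apply ev_imp with (P := fun t => forall i, (i < n)%nat -> forall k, (k < n)%nat -> P i k t).
  - auto.
  - apply (ev_all (fun i t => forall k, (k < n)%nat -> P i k t)); intros i Hi.
    apply (ev_all (P i)); auto.
Qed.

Lemma ev_gt_of_cv u l x : Un_cv u l -> x < l -> ev (fun t => x < u t).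
Proof.
  intros Hu Hx; destruct (Hu (l - x) ltac:(lra)) as [N HN]; exists N; intros n Hn.
  specialize (HN n Hn); revert HN; unfold Rdist, Rabs; destruct Rcase_abs; lra.
Qed.

Lemma ev_lt_mul x y : 0 < y -> ev (fun n => x < INR (S n) * y).
Proof.
  intros Hy; destruct (INR_unbounded (x / y)) as [N HN]; exists N; intros n Hn.
  apply Rlt_le_trans with (INR N * y).
  - apply Rmult_lt_reg_r with (/ y); [now apply Rinv_0_lt_compat|].
    rewrite Rmult_assoc, Rinv_r; lra.
  - apply Rmult_le_compat_r; [lra|apply le_INR; lia].
Qed.

(** The ceiling, cut off at 0, in the adjoint form that matches [cdiv_spec]. *)
Lemma nat_ceil x : exists c, forall c', (c <= c')%nat <-> x <= INR c'.
Proof.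
  destruct (INR_unbounded x) as [N HN].
  assert (HP : exists c, x <= INR c) by (exists N; lra).
  destruct (dec_inh_nat_subset_has_unique_least_element (fun c => x <= INR c)) as [c [[H1 H2] _]].
  - intros c; destruct (Rle_lt_dec x (INR c)); [now left|right; lra].
  - exact HP.
  - exists c; intros c'; split; [|apply H2].
    intros H; eapply Rle_trans; [exact H1|now apply le_INR].
Qed.

Section Universality.
Context (e : nat) (d : nat -> nat -> R) (nu de : nat -> nat -> nat -> nat)
  (d0 : forall i, d i i = 0) (dsym : forall i k, d i k = d k i)
  (dtri : forall i j k, d i k <= d i j + d j k) (dle : forall i k, d i k <= gamma)
  (lq_growing : forall i k, Un_growing (fun t => frac (nu i k t) (de i k t)))
  (lq_cv : forall i k, Un_cv (fun t => frac (nu i k t) (de i k t)) (d i k))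
  (e_code : forall i k t,
     ev (fun T => univ e (pr i (pr k t)) T = S (pr (nu i k t) (de i k t)))).

Lemma lq_le i k t : frac (nu i k t) (de i k t) <= d i k.
Proof. apply (growing_ineq (fun t => frac (nu i k t) (de i k t))); auto. Qed.

Lemma d_nonneg i k : 0 <= d i k.
Proof. eapply Rle_trans; [apply (frac_nonneg (nu i k 0) (de i k 0))|apply lq_le]. Qed.

(** By [univ_stable], a value read at any halting time is the eventual one. *)
Lemma entry_eq z i k : entry e z i k <> 0%nat ->
  entry e z i k = S (pr (nu i k (zt z)) (de i k (zt z))).
Proof.
  intros H; destruct (e_code i k (zt z)) as [N HN]; unfold entry in *.
  rewrite <- (univ_stable e _ _ (max N (p2 (p2 (p2 z)))) H ltac:(lia)).
  apply HN; lia.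
Qed.

Lemma num_eq z i k : entry e z i k <> 0%nat -> num e z i k = nu i k (zt z).
Proof. intros H; unfold num; rewrite (entry_eq z i k H); apply p1_pr. Qed.

Lemma den_eq z i k : entry e z i k <> 0%nat -> den e z i k = de i k (zt z).
Proof. intros H; unfold den; rewrite (entry_eq z i k H); apply p2_pr. Qed.

Lemma low_eq z i k : entry e z i k <> 0%nat -> low e z i k = frac (nu i k (zt z)) (de i k (zt z)).
Proof. intros H; unfold low; now rewrite num_eq, den_eq. Qed.

(* Rounding up is left-continuous, so the rounded values stabilize at the rounded true distance;
   being monotone and subadditive, it turns the metric [d] into a pseudometric. *)
Lemma ev_cdiv_ceil x i k c : (forall c', (c <= c')%nat <-> INR x * d i k <= INR c') ->
  ev (fun t => cdiv (x * nu i k t) (de i k t) = c).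
Proof.
  intros Hc.
  assert (Hle : forall t, (cdiv (x * nu i k t) (de i k t) <= c)%nat).
  { intros t; apply cdiv_spec, mul_frac_le.
    eapply Rle_trans; [apply Rmult_le_compat_l; [apply pos_INR|apply lq_le]|].
    now apply Hc. }
  destruct c as [|c].
  { exists 0%nat; intros t _; specialize (Hle t); lia. }
  assert (Hlt : INR c < INR x * d i k).
  { apply Rnot_le_lt; intros H; apply Hc in H; lia. }
  assert (Hcv := CV_mult _ _ _ _ (Un_cv_const (INR x)) (lq_cv i k)).
  apply ev_imp with (2 := ev_gt_of_cv _ _ _ Hcv Hlt); intros t Ht.
  enough (~ (cdiv (x * nu i k t) (de i k t) <= c)%nat) by (specialize (Hle t); lia).
  rewrite cdiv_spec; intros H; apply mul_frac_le in H; lra.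
Qed.

Lemma frac_self n : frac n n = 1 - / INR (S n).
Proof.
  assert (H := INR_S_pos n); unfold frac; rewrite S_INR in *; field; lra.
Qed.

Lemma frac_self_le1 n : frac n n <= 1.
Proof. rewrite frac_self; generalize (Rinv_0_lt_compat _ (INR_S_pos n)); lra. Qed.

(** Rounding costs less than one grid step, and a fine grid makes the gap between the two shrinking
    factors worth more. Strictness lets the bound survive when the distance [x] is replaced by a
    late lower bound. *)
Lemma ceil_scaled_lt n m x c :
  0 < x -> INR (S (S n)) < INR (S m) * x -> INR c < INR (n * S m) * x + 1 ->
  INR c / (INR (S n) * INR (S m)) < frac (S n) (S n) * x.
Proof.
  intros Hx Hm Hc; assert (P1 := INR_S_pos n); assert (P2 := INR_S_pos m).
  assert (P3 := INR_S_pos (S n)).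
  apply Rmult_lt_reg_r with (INR (S n) * INR (S m)); [now apply Rmult_lt_0_compat|].
  replace (INR c / (INR (S n) * INR (S m)) * (INR (S n) * INR (S m))) with (INR c)
    by (field; lra).
  eapply Rlt_le_trans; [exact Hc|].
  (* the slack of the two scaling factors is worth [INR (S m) * x / INR (S (S n)) > 1] *)
  apply Rmult_le_reg_r with (INR (S (S n))); [assumption|].
  replace (frac (S n) (S n) * x * (INR (S n) * INR (S m)) * INR (S (S n)))
    with (INR (S n) * x * (INR (S n) * INR (S m))) by (unfold frac; field; lra).
  rewrite mult_INR; rewrite !(S_INR (S n)), !(S_INR n) in *.
  generalize (pos_INR n); intros P0; nra.
Qed.

(** The parameters of a successful candidate are chosen in order: the grid [m] from the true
    distances, then the sampling index [t], then the running time [T]. *)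
Lemma stage_progress s0 : exists s, (zn (stage e s0) < zn (stage e s))%nat.
Proof.
  set (z0 := stage e s0); set (n := S (zn z0)).
  (* The grid must resolve every positive distance; zero distances round to 0 on any grid. *)
  destruct (ev_all2 (fun i k m => d i k = 0 \/ INR (S (S n)) < INR (S m) * d i k) n)
    as [m Hm].
  { intros i k _ _; destruct (Req_dec (d i k) 0) as [H|H].
    - exists 0%nat; auto.
    - apply ev_imp with (2 := ev_lt_mul (INR (S (S n))) (d i k) ltac:(generalize (d_nonneg i k); lra)).
      auto. }
  specialize (Hm m (le_n _)).
  set (x := (n * S m)%nat).
  (* [C i k] is the rounded true distance, the value that the candidate's entry takes once [t] is
     large. *)
  assert (HC : forall i, {C | forall k c', (C k <= c')%nat <-> INR x * d i k <= INR c'}).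
  { intros i.
    exists (fun k => proj1_sig (constructive_indefinite_description _ (nat_ceil (INR x * d i k)))).
    intros k; now destruct constructive_indefinite_description. }
  set (C i := proj1_sig (HC i)).
  assert (HCs : forall i k c', (C i k <= c')%nat <-> INR x * d i k <= INR c').
  { intros i; unfold C; now destruct (HC i). }
  assert (C0 : forall i, C i i = 0%nat).
  { intros i; enough (C i i <= 0)%nat by lia; apply HCs; rewrite d0; simpl; lra. }
  assert (Csym : forall i k, C i k = C k i).
  { intros i k; apply Nat.le_antisymm; apply HCs; rewrite dsym; now apply HCs. }
  assert (Ctri : forall i j k, (C i k <= C i j + C j k)%nat).
  { intros i j k; apply HCs; rewrite plus_INR.
    apply Rle_trans with (INR x * d i j + INR x * d j k).
    - rewrite <- Rmult_plus_distr_l; apply Rmult_le_compat_l; [apply pos_INR|apply dtri].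
    - apply Rplus_le_compat; now apply HCs. }
  set (sc := INR (S n) * INR (S m)).
  assert (Psc : 0 < sc) by (apply Rmult_lt_0_compat; apply INR_S_pos).
  assert (Clt : forall i k, (i < n)%nat -> (k < n)%nat ->
            C i k = 0%nat \/ INR (C i k) / sc < frac (S n) (S n) * d i k).
  { intros i k Hi Hk; destruct (Hm i k Hi Hk) as [H|H].
    - left; enough (C i k <= 0)%nat by lia; apply HCs; rewrite H; simpl; lra.
    - destruct (C i k) as [|c] eqn:E; [now left|right].
      apply ceil_scaled_lt; auto.
      + generalize (d_nonneg i k); intros [Hp|Hz]; [exact Hp|exfalso].
        rewrite <- Hz, Rmult_0_r in H; generalize (INR_S_pos (S n)); lra.
      + rewrite S_INR; fold x; enough (INR c < INR x * d i k) by lra.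
        apply Rnot_le_lt; intros Hc; apply HCs in Hc; lia. }
  destruct (ev_all2 (fun i k t => cdiv (x * nu i k t) (de i k t) = C i k /\
      INR (C i k) / sc <= frac (S n) (S n) * frac (nu i k t) (de i k t) /\
      INR (C i k) / sc <= gq t) n) as [t Ht].
  { intros i k Hi Hk; apply ev_and; [apply ev_cdiv_ceil; auto|].
    destruct (Clt i k Hi Hk) as [-> | H].
    - exists 0%nat; intros t _; simpl INR; rewrite Rdiv_0_l; split.
      + apply Rmult_le_pos; apply frac_nonneg.
      + apply frac_nonneg.
    - apply ev_and.
      + assert (Hcv := CV_mult _ _ _ _ (Un_cv_const (frac (S n) (S n))) (lq_cv i k)).
        apply ev_imp with (2 := ev_gt_of_cv _ _ _ Hcv H); intros t Ht; lra.
      + assert (H' : INR (C i k) / sc < gamma).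
        { apply Rlt_le_trans with (1 := H); apply Rle_trans with (2 := dle i k).
          rewrite <- (Rmult_1_l (d i k)) at 2; apply Rmult_le_compat_r;
            [apply d_nonneg|apply frac_self_le1]. }
        apply ev_imp with (2 := ev_gt_of_cv _ _ _ gq_cv H'); intros t Ht; lra. }
  (* Taking [t] at least [n] secures [ok_time]. *)
  specialize (Ht (max t n) ltac:(lia)).
  set (t' := max t n) in *; assert (Hnt : (n <= t')%nat) by (unfold t'; lia).
  clearbody t'; clear t; rename t' into t.
  destruct (ev_all2 (fun i k T => univ e (pr i (pr k t)) T = S (pr (nu i k t) (de i k t))) n)
    as [T HT].
  { intros i k _ _; apply e_code. }
  (* A running time of at least [s0] makes the code [s] at least [s0], so this candidate is not
     tried before stage [s0]. *)
  specialize (HT (max T s0) ltac:(lia)).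
  set (s := pr t (pr m (max T s0))).
  assert (Hs : (s0 <= s)%nat).
  { unfold s; generalize (pr_ge2 t (pr m (max T s0))) (pr_ge2 m (max T s0)); lia. }
  (* Either a point was accepted before round [s], or the stage is still [z0] and the candidate is
     tested in this round. *)
  destruct (Nat.lt_ge_cases (zn z0) (zn (stage e s))) as [H|H]; [now exists s|].
  exists (S s); assert (E := stage_fixed e s0 s Hs H); fold z0 in E.
  assert (Hz := stage_succ e s); cbv zeta in Hz; rewrite E in Hz; fold n in Hz.
  set (z := pr n s) in *.
  assert (Ezn : zn z = n) by apply p1_pr.
  assert (Ezt : zt z = t) by (unfold zt, z; rewrite p2_pr; apply p1_pr).
  assert (Ezm : zm z = m) by (unfold zm, z, s; now rewrite !p2_pr, p1_pr).
  assert (Esc : INR (S (scale z)) = sc) by now rewrite scale_INR, Ezn, Ezm.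
  assert (Hent : forall i k, (i < n)%nat -> (k < n)%nat -> entry e z i k <> 0%nat).
  { intros i k Hi Hk; unfold entry; rewrite Ezt; unfold z, s; rewrite !p2_pr, HT; auto. }
  assert (Hmat : forall i k, (i < n)%nat -> (k < n)%nat -> mat e z i k = C i k).
  { intros i k Hi Hk; unfold mat; rewrite num_eq, den_eq, Ezn, Ezm, Ezt by auto.
    now apply Ht. }
  assert (Hmd : forall i k, (i < n)%nat -> (k < n)%nat -> md e z i k = INR (C i k) / sc).
  { intros i k Hi Hk; unfold md, frac; now rewrite Hmat, Esc. }
  rewrite Hz, Ezn; [unfold n; lia| |].
  - split; rewrite ?Ezn, ?Ezt; auto.
    + intros i Hi; rewrite Hmat; auto.
    + intros i k Hi Hk; rewrite !Hmat; auto.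
    + intros i j k Hi Hj Hk; rewrite !Hmat; auto.
    + intros i k Hi Hk; rewrite Hmd, low_eq, Ezt by auto; now apply Ht.
    + intros i k Hi Hk; rewrite Hmd by auto; now apply Ht.
  (* Domination: the old metric is at most [n / (n + 1)] times its lower bounds, hence at most
     [n / (n + 1)] times [d], hence at most the rounded value. *)
  - intros i k Hi Hk; rewrite Hmd by (unfold n; lia).
    assert (Hok := stage_ok_all e s0); fold z0 in Hok.
    eapply Rle_trans; [apply (ok_low _ _ Hok); assumption|].
    rewrite low_eq by (now apply (ok_halt _ _ Hok)).
    fold n; apply Rle_trans with (frac n n * d i k).
    + apply Rmult_le_compat_l; [apply frac_nonneg|apply lq_le].
    + assert (Hx := proj1 (HCs i k _) (le_n _)); unfold x in Hx; rewrite mult_INR in Hx.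
      assert (P1 := INR_S_pos n); assert (P2 := INR_S_pos m).
      apply Rmult_le_reg_r with sc; [exact Psc|].
      replace (INR (C i k) / sc * sc) with (INR (C i k)) by (field; lra).
      eapply Rle_trans; [|exact Hx]; apply Req_le; unfold sc, frac; field; lra.
Qed.

Lemma zn_unbounded n : exists s, (n <= zn (stage e s))%nat.
Proof.
  induction n as [|n [s Hs]]; [exists 0%nat; lia|].
  destruct (stage_progress s) as [s' Hs']; exists s'; lia.
Qed.

Lemma D_le i k s : D e s i k <= d i k.
Proof.
  destruct (D_cases e s i k) as [[H1 [H2 ->]]|[_ [_ ->]]]; [|apply d_nonneg].
  assert (Hok := stage_ok_all e s).
  eapply Rle_trans; [apply (ok_low _ _ Hok); assumption|].
  rewrite low_eq by now apply (ok_halt _ _ Hok).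
  eapply Rle_trans; [|apply lq_le with (t := zt (stage e s))].
  rewrite <- (Rmult_1_l (frac (nu _ _ _) _)) at 2.
  apply Rmult_le_compat_r; [apply frac_nonneg|apply frac_self_le1].
Qed.

(** Sandwich: once [i] and [k] are active, [D] lies between [n / (n + 1)] times a lower bound and
    [d]. The size [n] is unbounded, and by [ok_time] so is the index of that lower bound. *)
Lemma D_cv i k : Un_cv (fun s => D e s i k) (d i k).
Proof.
  intros eps He.
  destruct (ev_gt_of_cv _ _ (d i k - eps / 2) (lq_cv i k) ltac:(lra)) as [N1 HN1].
  destruct (ev_lt_mul (d i k) (eps / 2) ltac:(lra)) as [N2 HN2].
  destruct (zn_unbounded (S (max (max N1 N2) (max i k)))) as [s0 Hs0]; exists s0; intros s Hs.
  assert (Hn := zn_stage_mono e s0 s Hs).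
  rewrite Rdist_sym; unfold Rdist; rewrite Rabs_pos_eq by (generalize (D_le i k s); lra).
  rewrite D_active by lia.
  assert (Hok := stage_ok_all e s); set (z := stage e s) in *.
  generalize (low_le_md e z i k); rewrite low_eq by (apply (ok_halt _ _ Hok); lia).
  assert (Ht := HN1 (zt z) ltac:(generalize (ok_time _ _ Hok); lia)).
  assert (Hd := HN2 (zn z) ltac:(lia)).
  assert (Hle := lq_le i k (zt z)); assert (Hp := frac_nonneg (nu i k (zt z)) (de i k (zt z))).
  cbv beta in Ht; revert Ht Hle Hp; generalize (frac (nu i k (zt z)) (de i k (zt z))); intros l.
  intros Ht Hle Hp; rewrite frac_self.
  assert (P := INR_S_pos (zn z)).
  assert (Hs1 : / INR (S (zn z)) * l < eps / 2).
  { apply Rmult_lt_reg_l with (INR (S (zn z))); [exact P|].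
    rewrite <- Rmult_assoc, Rinv_r by lra; lra. }
  lra.
Qed.

(** The point [k] is named with the first stage that accepts it. The search for this stage
    terminates by [zn_unbounded], hence is computable, and [idx] then returns [k] itself. *)
Lemma embedding_indices : exists h : nat -> nat,
  comp h /\ forall i k, pdist (h i) (h k) = d i k.
Proof.
  assert (HL : forall k, {s | (k < zn (stage e s))%nat /\
                 forall s', (s' < s)%nat -> ~ (k < zn (stage e s'))%nat}).
  { intros k; apply constructive_indefinite_description.
    destruct (dec_inh_nat_subset_has_unique_least_element (fun s => (k < zn (stage e s))%nat))
      as [s [[H1 H2] _]].
    - intros s; destruct (lt_dec k (zn (stage e s))); [now left|now right].
    - exact (zn_unbounded (S k)).
    - exists s; split; [exact H1|]; intros s' Hs' H; apply H2 in H; lia. }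
  set (f k := proj1_sig (HL k)).
  assert (Hf : comp f).
  { apply comp_min with (fun s k => (S k - zn (stage e s))%nat); [comp|].
    intros k; unfold f; destruct (HL k) as [s [H1 H2]]; simpl proj1_sig; split; [lia|].
    intros s' Hs'; specialize (H2 s' Hs'); lia. }
  exists (fun k => pr e (pr k (f k))); split; [comp|]; intros i k.
  assert (Hidx : forall j, idx (pr e (pr j (f j))) = j).
  { intros j; unfold idx; rewrite !p2_pr, !p1_pr; unfold f.
    destruct (HL j) as [s [H1 H2]]; simpl proj1_sig.
    now replace (S j - zn (stage e s))%nat with 0%nat by lia. }
  apply pdist_unique; intros eps He; destruct (D_cv i k eps He) as [N HN].
  exists N; intros n Hn; rewrite approx_same, p1_pr, !Hidx by now rewrite !p1_pr.
  now apply HN.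
Qed.

End Universality.
End Stages.

Local Open Scope R_scope.

(** * Truncation of rational codes at 0 and assembly of the theorem *)

(** Codes of left-c.e. reals may be negative, while the stages use nonnegative fractions. Truncated
    subtraction is the maximum with 0, which preserves monotonicity and nonnegative limits. *)
Lemma frac_truncated_sub a b c : frac (a - b) c = Rmax (ratcode a b c) 0.
Proof.
  unfold ratcode; rewrite <- S_INR; assert (P := INR_S_pos c).
  destruct (le_ge_dec b a) as [H|H].
  - rewrite <- minus_INR by exact H; fold (frac (a - b) c).
    rewrite Rmax_left; [reflexivity|apply frac_nonneg].
  - replace (a - b)%nat with 0%nat by lia; rewrite frac_0, Rmax_right; [reflexivity|].
    apply Rmult_le_reg_r with (INR (S c)); [exact P|].
    unfold Rdiv; rewrite Rmult_assoc, Rinv_l by lra.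
    apply le_INR in H; lra.
Qed.

Lemma frac_truncated_growing a b c :
  (forall s : nat, ratcode (a s) (b s) (c s) <= ratcode (a (S s)) (b (S s)) (c (S s))) ->
  Un_growing (fun s => frac (a s - b s) (c s)).
Proof.
  intros H s; rewrite !frac_truncated_sub; specialize (H s).
  unfold Rmax; repeat destruct Rle_dec; lra.
Qed.

Lemma frac_truncated_cv a b c x : 0 <= x ->
  Un_cv (fun s : nat => ratcode (a s) (b s) (c s)) x -> Un_cv (fun s => frac (a s - b s) (c s)) x.
Proof.
  intros Hx H eps He; destruct (H eps He) as [N HN]; exists N; intros n Hn.
  specialize (HN n Hn); rewrite frac_truncated_sub; revert HN.
  unfold Rdist, Rmax; destruct Rle_dec; auto.
  unfold Rabs; repeat destruct Rcase_abs; lra.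
Qed.

Theorem mainTheorem14 (gamma : R) :
  left_ce gamma -> 0 < gamma ->
  exists U : PolishSpace,
    left_ce_space U /\ diam_le U gamma /\
    forall M : PolishSpace, left_ce_space M -> diam_le M gamma ->
      exists f : carrier M -> carrier U, computable_embedding M U f.
Proof.
  intros [a [b [c [Ha [Hb [Hc [Hg Hcv]]]]]]] Hpos.
  set (gn s := (a 0 s - b 0 s)%nat); set (gd s := c 0%nat s).
  assert (Hgn : comp gn).
  { apply comp_sub; apply comp_op2; auto using comp_const, comp_id. }
  assert (Hgd : comp gd) by (apply comp_op2; auto using comp_const, comp_id).
  assert (Hgrow : Un_growing (gq gn gd)) by now apply frac_truncated_growing.
  assert (Hlim : Un_cv (gq gn gd) gamma) by (apply frac_truncated_cv; [lra|assumption]).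
  exists (universal gn gd gamma Hgrow Hlim); split; [now apply universal_left_ce|].
  split; [apply universal_diam|].
  intros M [a' [b' [c' [Ha' [Hb' [Hc' HM]]]]]] Hdiam.
  set (nu i k t := (a' i k t - b' i k t)%nat).
  (* The component of [M] is the number of a program for its truncated distance approximations, with
     the arguments packed as a triple. *)
  destruct (univ_universal (fun w => pr (nu (p1 w) (p1 (p2 w)) (p2 (p2 w)))
                                        (c' (p1 w) (p1 (p2 w)) (p2 (p2 w))))) as [e He].
  { apply comp_pr; [apply comp_sub|]; apply comp_op3;
      auto using comp_p1, comp_p2, comp_id. }
  destruct (embedding_indices gn gd Hgn Hgd gamma Hgrow Hlim e
              (fun i k => dist M (pts M i) (pts M k)) nu c') as [h [Hh Hd]].
  - intros i; apply dist_refl.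
  - intros i k; apply dist_sym.
  - intros i j k; apply dist_tri.
  - intros i k; apply Hdiam.
  - intros i k; apply frac_truncated_growing, HM.
  - intros i k; apply frac_truncated_cv; [apply dist_nonneg|apply HM].
  - intros i k t; destruct (He (pr i (pr k t))) as [N HN]; exists N; intros n Hn.
    rewrite HN, !p2_pr, !p1_pr by exact Hn; reflexivity.
  - set (U := universal gn gd gamma Hgrow Hlim).
    destruct (isometric_extension M U (fun k => pts U (h k))) as [f [Hf Hfp]].
    { intros i k; unfold U; rewrite universal_dist; apply Hd. }
    exists f; split; [exact Hf|].
    (* Special points are sent to special points, so constant Cauchy names suffice. *)
    exists (fun k _ => h k); split.
    { apply computable2_comp, (comp_comp h); auto using comp_p1, comp_id. }
    intros k; rewrite Hfp; split.
    + intros i j _; rewrite dist_refl; apply pow_le; lra.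
    + rewrite dist_refl; apply Un_cv_const.
Qed.
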